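(* Let $n\ge 2$. There is a bijection between the set of order ideals of the poset $T_n(\{b,r,g\})$ and the set of tournaments on $n$ vertices.
   Context: Let $T_n$ be the set of triples $(c_1,c_2,c_3)$ of nonnegative integers with $c_1+c_2+c_3\le n-2$, and let $v_r=(1,0,0)$, $v_g=(0,1,0)$, $v_b=(-1,1,0)$. $T_n(\{b,r,g\})$ is the poset on $T_n$ whose order is the reflexive–transitive closure of the relations $p<p+v_x$ for $x\in\{r,g,b\}$ and $p,p+v_x\in T_n$. An order ideal is a down-closed subset (including $\emptyset$). A tournament on $n$ vertices is a directed graph on the labeled vertex set $\{1,\dots,n\}$ with exactly one directed edge between each pair of distinct vertices (the edge $i\to j$ meaning $i$ beats $j$). *)

(* Defs.v *)
From HB Require Import structures.
From mathcomp Require Import all_boot all_order all_algebra.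
From mathcomp Require Import zify.

Set Implicit Arguments.
Unset Strict Implicit.
Unset Printing Implicit Defensive.

Import Order.TTheory GRing.Theory Num.Theory.
Local Open Scope order_scope.

(* For 2 <= n each coordinate of a triple of natural numbers with sum at most
   n - 2 is smaller than n.-1, so the bound 'I_n.-1 excludes no triple. *)
Record tetra (n : nat) := Tetra {
  tetra_val : 'I_n.-1 * 'I_n.-1 * 'I_n.-1;
  _ : (tetra_val.1.1 + tetra_val.1.2 + tetra_val.2 <= n - 2)%N
}.

HB.instance Definition _ n := [isSub for @tetra_val n].
HB.instance Definition _ n := [Finite of tetra n by <:].

Definition coords n (p : tetra n) : int * int * int :=
  let: (c1, c2, c3) := val p in (Posz c1, Posz c2, Posz c3).

Definition v_r : int * int * int := (1, 0, 0)%R.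
Definition v_g : int * int * int := (0, 1, 0)%R.
Definition v_b : int * int * int := (-1, 1, 0)%R.

Definition step n : rel (tetra n) :=
  fun p q => has (fun v => coords q == (coords p + v)%R) [:: v_b; v_r; v_g].

(* [connect] is the reflexive-transitive closure. *)
Definition tetra_le n : rel (tetra n) := connect (@step n).

Lemma tetra_le_refl n : reflexive (@tetra_le n).
Proof. exact: connect0. Qed.

Lemma tetra_le_trans n : transitive (@tetra_le n).
Proof. exact: connect_trans. Qed.

(* The weight c1 + 2 c2 increases by 1 or 2 along every step. *)
Definition weight n (p : tetra n) : nat :=
  ((val p).1.1 + 2 * (val p).1.2)%N.

Lemma step_weight n (p q : tetra n) : step p q -> (weight p < weight q)%N.
Proof.
case: p => [[[a b] c] /= ?]; case: q => [[[a' b'] c'] /= ?].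
rewrite /step /weight /coords /v_b /v_r /v_g /=.
by case/or4P => // /eqP[]; lia.
Qed.

Lemma tetra_le_weight n (p q : tetra n) :
  tetra_le p q -> p = q \/ (weight p < weight q)%N.
Proof.
case/connectP => s; elim: s p => [|x s IHs] p /=; first by left.
case/andP => /step_weight lt_px /IHs h /h [<- | lt_xq]; right => //.
exact: ltn_trans lt_xq.
Qed.

Lemma tetra_le_anti n : antisymmetric (@tetra_le n).
Proof.
move=> p q /andP[/tetra_le_weight[//|pq] /tetra_le_weight[//|qp]].
by have := ltn_trans pq qp; rewrite ltnn.
Qed.

Fact tetra_display : Order.disp_t. Proof. exact: Order.Disp tt tt. Qed.

HB.instance Definition _ n := Order.Le_isPOrder.Build tetra_display (tetra n)
  (@tetra_le_refl n) (@tetra_le_anti n) (@tetra_le_trans n).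

Lemma tetra_leE n (p q : tetra n) : (p <= q) = connect (@step n) p q.
Proof. by []. Qed.

Definition is_order_ideal d (T : finPOrderType d) (I : {set T}) : bool :=
  [forall x in I, forall y, (y <= x) ==> (y \in I)].

Definition order_ideal d (T : finPOrderType d) := {I : {set T} | is_order_ideal I}.

(* (i, j) \in E reads i -> j; the vertices 1, ..., n are numbered from 0 here. *)
Definition is_tournament n (E : {set 'I_n * 'I_n}) : bool :=
  [forall i, (i, i) \notin E] &&
  [forall i, forall j, (i != j) ==> (((i, j) \in E) (+) ((j, i) \in E))].

Definition tournament n := {E : {set 'I_n * 'I_n} | is_tournament E}.

(* Main.v *)
Require Import Defs.
From mathcomp Require Import all_boot all_order.
From mathcomp Require Import zify.

(* All three vectors preserve c3, so an ideal is a family of ideals of the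
   triangles {(a, b) : a + b <= n - 2 - k}, one for each k = c3.  Such an ideal
   is given by its column heights h(a) = #{b : (a, b, k) in I}, and being
   down-closed means exactly h(a + 1) <= h(a) <= h(a + 1) + 1.  The drop
   h(a) - h(a + 1) in {0, 1} is free for every a <= n - 2 - k, and we let it
   decide whether vertex k beats vertex k + a + 1. *)

Set Implicit Arguments.
Unset Strict Implicit.
Unset Printing Implicit Defensive.

Lemma down_closed_find (P : pred nat) n b :
    (forall i, P i.+1 -> P i) -> (forall i, P i -> i < n) ->
  P b = (b < find (predC P) (iota 0 n)).
Proof.
move=> dP bP; set m := find _ _.
have dP' i j : i <= j -> P j -> P i.
  by move=> /subnK <-; elim: (j - i) => // d IHd /dP.
apply/idP/idP => [Pb|ltbm]; last first.
  have ltbn : b < n.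
    by apply: leq_trans ltbm _; rewrite -[leqRHS](size_iota 0) find_size.
  by have := before_find 0 ltbm; rewrite nth_iota //= => /negbFE.
rewrite ltnNge; apply/negP => lemb.
have ltmn : m < n by apply: leq_ltn_trans lemb (bP _ Pb).
have : has (predC P) (iota 0 n) by rewrite has_find size_iota.
by move=> /(nth_find 0); rewrite -/m nth_iota //= (dP' _ _ lemb Pb).
Qed.

Section Tetra.

Variable n : nat.
Implicit Types (I : {set tetra n}) (E : {set 'I_n * 'I_n}) (p q : tetra n).

Definition has_coords a b c p : bool :=
  [&& (val p).1.1 == a :> nat, (val p).1.2 == b :> nat & (val p).2 == c :> nat].

Lemma has_coords_inj a b c p q : has_coords a b c p -> has_coords a b c q -> p = q.
Proof.
move=> /and3P[/eqP pa /eqP pb /eqP pc] /and3P[/eqP qa /eqP qb /eqP qc].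
apply: val_inj; move: pa pb pc qa qb qc.
case: (val p) (val q) => [[a1 b1] c1] [[a2 b2] c2] /= pa pb pc qa qb qc.
by congr (_, _, _); apply: val_inj; rewrite /= ?pa ?pb ?pc ?qa ?qb ?qc.
Qed.

Lemma tetra_ex a b c :
  2 <= n -> a + b + c <= n - 2 -> exists p, has_coords a b c p.
Proof.
move=> hn habc.
have [ha hb hc] : [/\ a < n.-1, b < n.-1 & c < n.-1] by split; lia.
exists (@Tetra n (Ordinal ha, Ordinal hb, Ordinal hc) habc).
by rewrite /has_coords /= !eqxx.
Qed.

(** Membership extended by [false] to all natural coordinates, so that columns can be followed past
    the boundary without carrying bounds. *)
Definition at_coords I a b c : bool := [exists p in I, has_coords a b c p].

Lemma at_coordsP I a b c p : has_coords a b c p -> at_coords I a b c = (p \in I).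
Proof.
move=> hp; apply/existsP/idP => [[q /andP[qI hq]]|pI]; last first.
  by exists p; rewrite pI.
by rewrite (has_coords_inj hp hq).
Qed.

Lemma at_coords_bound I a b c : at_coords I a b c -> a + b + c <= n - 2.
Proof.
by case/existsP => p /andP[_ /and3P[/eqP<- /eqP<- /eqP<-]]; apply: (valP p).
Qed.

Lemma at_coords_step I (a b c a' b' : nat) :
    2 <= n -> is_order_ideal I ->
    [|| (a' == a.+1) && (b' == b), (a' == a) && (b' == b.+1)
      | (a == a'.+1) && (b' == b.+1)] ->
  at_coords I a' b' c -> at_coords I a b c.
Proof.
move=> hn idI st at'; have le' := at_coords_bound at'.
(* None of the three vectors lowers the coordinate sum, so the lower point exists as soon as the
   upper one does. *)
have le_ : a + b + c <= n - 2 by move: st; lia.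
have [p hp] := tetra_ex hn le_.
have [q hq] := tetra_ex hn le'.
rewrite (at_coordsP _ hp); rewrite (at_coordsP _ hq) in at'.
have /forallP/(_ q)/implyP/(_ at')/forallP/(_ p)/implyP := idI; apply.
rewrite tetra_leE; apply: connect1.
move: hp hq st; rewrite /has_coords /step /coords /v_b /v_r /v_g.
case: (val p) (val q) => [[a1 b1] c1] [[a2 b2] c2] /=.
move=> /and3P[/eqP pa /eqP pb /eqP pc] /and3P[/eqP qa /eqP qb /eqP qc].
have eq3 (u w : ssrint.int * ssrint.int * ssrint.int) :
    u.1.1 = w.1.1 -> u.1.2 = w.1.2 -> u.2 = w.2 -> u = w.
  by case: u w => [[? ?] ?] [[? ?] ?] /= -> -> ->.
case/or3P => /andP[/eqP ea /eqP eb]; apply/or4P.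
- by apply: Or42; apply/eqP/eq3 => /=; lia.
- by apply: Or43; apply/eqP/eq3 => /=; lia.
- by apply: Or41; apply/eqP/eq3 => /=; lia.
Qed.

Definition height I c a := find (predC (at_coords I a ^~ c)) (iota 0 n).

Lemma heightP I a b c :
  2 <= n -> is_order_ideal I -> at_coords I a b c = (b < height I c a).
Proof.
move=> hn idI; apply: (@down_closed_find (at_coords I a ^~ c)) => [i|i].
  by apply: at_coords_step => //; rewrite !eqxx orbT.
by move/at_coords_bound; lia.
Qed.

(** The left inequality comes from [v_r], which puts (a, b) below (a + 1, b). The right one comes
    from [v_b], which puts (a + 1, b) below (a, b + 1). *)
Lemma height_bounds I c a : 2 <= n -> is_order_ideal I ->
  height I c a.+1 <= height I c a <= (height I c a.+1).+1.
Proof.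
move=> hn idI; apply/andP.
split; rewrite leqNgt; apply/negP; rewrite -heightP // => h.
  suff : at_coords I a (height I c a) c by rewrite heightP // ltnn.
  by apply: at_coords_step h; rewrite // !eqxx.
suff : at_coords I a.+1 (height I c a.+1) c by rewrite heightP // ltnn.
by apply: at_coords_step h; rewrite // !eqxx !orbT.
Qed.

(** Column n - 1 - c is already empty, so the last drop, out of column n - 2 - c, is the height of
    that column; it matches the last vertex n - 1. *)
Lemma height_out I c a : 2 <= n -> is_order_ideal I -> n <= c + a.+1 ->
  height I c a = 0.
Proof.
move=> hn idI hca; apply/eqP; rewrite -leqn0 leqNgt -heightP //.
by apply/negP => /at_coords_bound; lia.
Qed.

(** The tournament's counterpart of the height of column a at level i: edges from i to i + a' + 1
    stand for drops out of column a', and the drops with a' >= a add up to the height. *)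
Definition beaten E (i : 'I_n) a :=
  #|[set j : 'I_n | (i + a < j) && ((i, j) \in E)]|.

Lemma beaten_out E (i : 'I_n) a : n <= i + a.+1 -> beaten E i a = 0.
Proof.
move=> h; apply: eq_card0 => j; rewrite !inE.
by apply/negbTE; have := ltn_ord j; lia.
Qed.

Lemma beatenS E (i : 'I_n) a (j : 'I_n) : j = i + a.+1 :> nat ->
  beaten E i a = ((i, j) \in E) + beaten E i a.+1.
Proof.
move=> hj; rewrite /beaten (cardsD1 j) inE; congr (_ + _).
  by rewrite (_ : i + a < j) //; lia.
apply: eq_card => k; rewrite !inE -val_eqE /=.
by case: (_ \in E); rewrite ?andbT ?andbF //; lia.
Qed.

Lemma beaten_bound E (i : 'I_n) a : beaten E i a <= n - (i + a.+1).
Proof.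
move Dm: (n - _) => m; elim: m a Dm => [|m IHm] a Dm.
  by rewrite beaten_out //; lia.
have hj : i + a.+1 < n by lia.
rewrite (@beatenS _ _ a (Ordinal hj)) //.
have := IHm a.+1; case: (_ \in E); lia.
Qed.

Lemma beaten_bounds E i a : beaten E i a.+1 <= beaten E i a <= (beaten E i a.+1).+1.
Proof.
have [hj|hj] := ltnP (i + a.+1) n.
  by rewrite (@beatenS _ _ a (Ordinal hj)) //; case: (_ \in E); lia.
by rewrite !beaten_out //; lia.
Qed.

Lemma tournamentC E (i j : 'I_n) : is_tournament E -> j < i ->
  ((i, j) \in E) = ((j, i) \notin E).
Proof.
case/andP => _ /forallP/(_ i)/forallP/(_ j)/implyP; rewrite -val_eqE /= => h ltji.
by have := h (negbT (gtn_eqF ltji)); case: (_ \in E); case: (_ \in E).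
Qed.

Lemma tournament_eq E E' : is_tournament E -> is_tournament E' ->
  (forall i j : 'I_n, i < j -> ((i, j) \in E) = ((i, j) \in E')) -> E = E'.
Proof.
move=> tE tE' eqE; apply/setP => -[i j].
have [ltij|ltji|/val_inj <-] := ltngtP i j; first exact: eqE.
  by rewrite (tournamentC tE ltji) (tournamentC tE' ltji) eqE.
by move: tE tE' => /andP[/forallP/(_ i)/negbTE-> _] /andP[/forallP/(_ i)/negbTE->].
Qed.

Definition vertex p : 'I_n := widen_ord (leq_pred n) (val p).2.

Definition ideal_set E : {set tetra n} :=
  [set p : tetra n | (val p).1.2 < beaten E (vertex p) (val p).1.1].

(** Closure along single steps suffices, by induction on the path. Steps fix the third coordinate,
    hence the vertex, and [beaten_bounds] gives the two inequalities that an ideal needs. *)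
Lemma ideal_setP E : is_order_ideal (ideal_set E).
Proof.
suff dE p q : step p q -> q \in ideal_set E -> p \in ideal_set E.
  apply/forallP => q; apply/implyP => qI; apply/forallP => p.
  rewrite tetra_leE; apply/implyP => /connectP[s].
  elim: s p => [|x s IHs] p /=; first by move=> _ <-.
  by case/andP => /dE px /IHs h /h /px.
rewrite !inE => st; have eqv : vertex p = vertex q.
  apply: val_inj; move: st; rewrite /step /coords /v_b /v_r /v_g /=.
  case: (val p) (val q) => [[a1 b1] c1] [[a2 b2] c2] /=.
  by case/or4P => // /eqP[]; lia.
rewrite eqv; move: st (vertex q) => + i; rewrite /step /coords /v_b /v_r /v_g /=.
case: (val p) (val q) => [[a1 b1] c1] [[a2 b2] c2] /=.
case/or4P => // /eqP[] ea eb _.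
(* The cases are [v_b], [v_r] and [v_g], in this order. *)
- have -> : nat_of_ord a1 = a2.+1 by lia.
  by have := beaten_bounds E i a2; lia.
- have -> : nat_of_ord a2 = a1.+1 by lia.
  by have := beaten_bounds E i a1; lia.
- have -> : nat_of_ord a2 = a1 by lia.
  by lia.
Qed.

Definition ideal_of (E : tournament n) : order_ideal (tetra n) :=
  exist _ (ideal_set (val E)) (ideal_setP (val E)).

Lemma at_ideal_set E (i : 'I_n) a b : 2 <= n ->
  a + b + i <= n - 2 -> at_coords (ideal_set E) a b i = (b < beaten E i a).
Proof.
move=> hn /(tetra_ex hn)[p hp]; rewrite (at_coordsP _ hp) inE.
case/and3P: hp => /eqP-> /eqP-> /eqP pc.
by congr (_ < beaten _ _ _); apply: val_inj.
Qed.

(** Were the count for [E] larger, the point at height [beaten E' i a] in column a would lie in the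
    first ideal and not in the second. By [beaten_bound] this point does fit in the triangle. *)
Lemma beaten_le E E' i a : 2 <= n -> ideal_set E = ideal_set E' ->
  beaten E i a <= beaten E' i a.
Proof.
move=> hn eqI; rewrite leqNgt; apply/negP => lt.
have le_ : a + beaten E' i a + i <= n - 2 by have := beaten_bound E i a; lia.
by move: (lt); rewrite -at_ideal_set // eqI at_ideal_set // ltnn.
Qed.

Lemma ideal_of_inj : 2 <= n -> injective ideal_of.
Proof.
move=> hn [E tE] [E' tE'] /(congr1 val) /= eqI; apply: val_inj => /=.
have eqb i a : beaten E i a = beaten E' i a.
  by apply/eqP; rewrite eqn_leq !beaten_le.
apply: tournament_eq => // i j ltij.
(* The edge between i and j is the difference of two consecutive counts, at a = j - i - 1 and a +
   1. *)
have hj : j = i + (j - i.+1).+1 :> nat by lia.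
have := eqb i (j - i.+1); rewrite !(beatenS _ hj) eqb => /addIn.
by case: (_ \in E); case: (_ \in E').
Qed.

(** For i < j this is the drop from column a = j - i - 1 to column a + 1 at level i. *)
Definition drop I (i j : 'I_n) : bool :=
  height I i (j - i) < height I i (j - i.+1).

Definition tournament_set I : {set 'I_n * 'I_n} :=
  [set e : 'I_n * 'I_n | if e.1 < e.2 then drop I e.1 e.2
                         else (e.2 < e.1) && ~~ drop I e.2 e.1].

Lemma tournament_setP I : is_tournament (tournament_set I).
Proof.
apply/andP; split; first by apply/forallP => i; rewrite inE /= ltnn.
apply/forallP => i; apply/forallP => j; apply/implyP; rewrite -val_eqE /= !inE /=.
by case: ltngtP => //= _ _; [case: (drop I i j) | case: (drop I j i)].
Qed.

Definition tournament_of (I : order_ideal (tetra n)) : tournament n :=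
  exist _ (tournament_set (val I)) (tournament_setP (val I)).

(** Downward induction on a: both sides vanish once i + a + 1 >= n, and both grow by the same drop,
    0 or 1, when a decreases by one. *)
Lemma beaten_height I (i : 'I_n) a : 2 <= n -> is_order_ideal I ->
  beaten (tournament_set I) i a = height I i a.
Proof.
move=> hn idI; move Dm: (n - (i + a.+1)) => m.
elim: m a Dm => [|m IHm] a Dm; first by rewrite beaten_out ?height_out //; lia.
have hj : i + a.+1 < n by lia.
rewrite (@beatenS _ _ a (Ordinal hj)) // IHm; last by lia.
rewrite inE /= /drop /= (_ : i < i + a.+1); last by lia.
rewrite (_ : i + a.+1 - i = a.+1); last by lia.
rewrite (_ : i + a.+1 - i.+1 = a); last by lia.
by have := height_bounds i a hn idI; lia.
Qed.

Lemma tournament_ofK : 2 <= n -> cancel tournament_of ideal_of.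
Proof.
move=> hn [I idI]; apply: val_inj; apply/setP => p /=.
rewrite inE beaten_height // -heightP //.
by apply: at_coordsP; rewrite /has_coords /= !eqxx.
Qed.

End Tetra.

Theorem theorem15 (n : nat) (hn : 2 <= n) :
  exists f : order_ideal (tetra n) -> tournament n, bijective f.
Proof.
exists (@tournament_of n); exists (@ideal_of n); first exact: tournament_ofK.
(* Injectivity of [ideal_of] turns its right inverse into a two-sided one. *)
exact: inj_can_sym (tournament_ofK hn) (ideal_of_inj hn).
Qed.
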